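(* Let $X$ be a zero-dimensional compact space. If $\{r_s : s\in\Gamma\}$ is an $r$-skeleton on $X$ such that $|r_s(X)|\le\omega$ for all $s\in\Gamma$, then $X$ has a dense subset consisting of isolated points of $X$.
   Context: All spaces are Tychonoff (completely regular and Hausdorff). Zero-dimensional means having a base of clopen sets. A retraction in $X$ is a continuous map $r:X\to X$ with $r\circ r=r$. A space is cosmic if it has a countable network. A partially ordered set $\Gamma$ is up-directed if any two elements have a common upper bound, and $\sigma$-complete if every increasing sequence $\langle s_n\rangle_{n<\omega}$ in $\Gamma$ has a supremum in $\Gamma$. An $r$-skeleton on a space $X$ is a family $\{r_s:s\in\Gamma\}$ of retractions in $X$, indexed by an up-directed $\sigma$-complete partially ordered set $\Gamma$, such that: (i) $r_s(X)$ is cosmic for each $s\in\Gamma$; (ii) $r_s=r_s\circ r_t=r_t\circ r_s$ whenever $s\le t$; (iii) if $\langle s_n\rangle_{n<\omega}\subseteq\Gamma$ is increasing and $s=\sup\{s_n:n<\omega\}$, then $r_s(x)=\lim_{n\to\infty}r_{s_n}(x)$ for each $x\in X$; (iv) $x=\lim_{s\in\Gamma}r_s(x)$ for each $x\in X$. *)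

(* Defs.v *)
From mathcomp Require Import all_boot all_order all_classical.
From mathcomp Require Import topology normedtype sequences.

Set Implicit Arguments.
Unset Strict Implicit.
Unset Printing Implicit Defensive.

Local Open Scope classical_set_scope.

Definition tychonoff_space (X : topologicalType) : Prop :=
  completely_regular_space X /\ hausdorff_space X.

(* The library's [zero_dimensional] only asks that clopen sets separate
   points, which is weaker in general. *)
Definition has_clopen_base (X : topologicalType) : Prop :=
  exists2 B : set (set X), basis B & B `<=` clopen.

Definition network (X : topologicalType) (N : set (set X)) : Prop :=
  forall (x : X) (U : set X), open U -> U x ->
    exists A : set X, [/\ N A, A x & A `<=` U].

Definition cosmic (X : topologicalType) : Prop :=
  exists2 N : set (set X), countable N & network N.

Definition retraction (X : topologicalType) (r : X -> X) : Prop :=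
  continuous r /\ r \o r = r.

Definition up_directed (d : Order.disp_t) (Gamma : porderType d) : Prop :=
  forall s t : Gamma, exists u : Gamma, (s <= u)%O /\ (t <= u)%O.

Definition sigma_complete (d : Order.disp_t) (Gamma : porderType d) : Prop :=
  forall s : nat -> Gamma, nondecreasing_seq s ->
    exists t : Gamma, supremums (range s) t.

(* The sets containing some tail [{t | s <= t}]; convergence along it is
   convergence of nets indexed by [Gamma]. *)
Definition net_filter (d : Order.disp_t) (Gamma : porderType d) :
    set_system Gamma :=
  filter_from [set: Gamma] (fun s => [set t | (s <= t)%O]).
Arguments net_filter {d} Gamma.

(* [set_type A] carries the subspace topology of [A]. *)
Record r_skeleton (X : topologicalType) (d : Order.disp_t)
    (Gamma : porderType d) (r : Gamma -> X -> X) : Prop := RSkeleton {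
  rsk_directed : up_directed Gamma;
  rsk_sigma_complete : sigma_complete Gamma;
  rsk_retraction : forall s, retraction (r s);
  rsk_cosmic : forall s, cosmic (set_type (range (r s)));
  rsk_comp : forall s t : Gamma, (s <= t)%O ->
    r s = r s \o r t /\ r s = r t \o r s;
  rsk_sup : forall (u : nat -> Gamma) (s : Gamma), nondecreasing_seq u ->
    supremums (range u) s -> forall x, (fun n => r (u n) x) @ \oo --> r s x;
  rsk_lim : forall x, (fun s => r s x) @ net_filter Gamma --> x
}.

(* Main.v *)
Require Import Defs.
From mathcomp Require Import all_boot all_order all_classical.
From mathcomp Require Import topology normedtype sequences.

Local Open Scope classical_set_scope.

(** If the isolated points were not dense, some nonempty clopen set [U] would
contain none of them.  Every nonempty clopen subset of [U] then has two points
and splits into two nonempty clopen pieces, so [U] carries a Cantor scheme: a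
binary tree of nonempty clopen sets, each node containing its two disjoint
children ([exists_cantor_scheme]).  Choose a point [x_a] in each node [V_a].
Since [r_s x_a] converges to [x_a], there is an index [t_a] beyond which
[r_s x_a] stays in the open set [V_a].  There are only countably many nodes, and
a directed sigma-complete order bounds every countable family
([countable_family_bounded]), so one index [s] lies above all the [t_a], and the
range of [r_s] meets every node.

That range is compact, being a continuous image of [X], so it has a point in the
intersection of the nodes along each of the continuum many branches, and
distinct branches have disjoint intersections.  A compact set meeting every node
is therefore uncountable ([cantor_scheme_uncountable]), against the hypothesis
that all ranges are countable. *)

(** * Countable families in directed sigma-complete orders *)

(** A sequence need not have comparable terms, so sigma-completeness is applied
to the increasing majorant that directedness provides. *)
Lemma sequence_bounded {d : Order.disp_t} {Gamma : porderType d}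
    (v : nat -> Gamma) :
  up_directed Gamma -> sigma_complete Gamma -> exists s, forall n, (v n <= s)%O.
Proof.
move=> dirG sigG.
have [join joinP] := choice (fun p : Gamma * Gamma => dirG p.1 p.2).
pose u := fix u n := if n is m.+1 then join (u m, v m.+1) else v 0.
have vu n : (v n <= u n)%O.
  by case: n => [|n] //=; have [_] := joinP (u n, v n.+1).
have u_nondecr : nondecreasing_seq u.
  by apply/nondecreasing_seqP => n /=; have [] := joinP (u n, v n.+1).
have [s [us _]] := sigG u u_nondecr.
exists s => n; apply: Order.POrderTheory.le_trans (vu n) _.
by apply: us; exists n.
Qed.

Lemma countable_family_bounded {d : Order.disp_t} {Gamma : porderType d}
    {I : countType} (i0 : I) (v : I -> Gamma) :
  up_directed Gamma -> sigma_complete Gamma -> exists s, forall i, (v i <= s)%O.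
Proof.
move=> dirG sigG.
have [s vs] := sequence_bounded (fun n => v (odflt i0 (unpickle n))) dirG sigG.
by exists s => i; have := vs (pickle i); rewrite pickleK.
Qed.

(** * Compact sets meeting every node of a Cantor scheme *)

(** Cantor's intersection theorem relative to [K]: the traces of the sets on [K]
generate a proper filter, and its cluster points lie in each closed set. *)
Lemma compact_nested_meets {X : topologicalType} {K : set X}
    (V : nat -> set X) :
  compact K -> (forall n, closed (V n)) -> (forall n, V n.+1 `<=` V n) ->
  (forall n, K `&` V n !=set0) -> exists2 p, K p & forall n, V n p.
Proof.
move=> cK clV nestV meetV.
have Vle m n : m <= n -> V n `<=` V m.
  move=> /subnK <-; elim: (n - m)%N => // k IH.
  by rewrite addSn; apply: subset_trans IH; exact: nestV.
pose F := filter_from [set: nat] (fun n => K `&` V n).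
have FF : ProperFilter F.
  apply: filter_from_proper => [|n _]; last exact: meetV.
  apply: filter_fromT_filter => [|m n]; first by exists 0.
  exists (maxn m n) => x [Kx Vx].
  by split; split=> //; apply: Vle Vx; rewrite ?leq_maxl ?leq_maxr.
have [|p [Kp clp]] := cK F FF; first by exists 0 => // x [].
exists p => // n; apply: clV => B Bp.
by apply: clp Bp; exists n => // x [].
Qed.

(** A word lists the turns of a path in reverse: its head is the last one, so
that [b :: a] is a child of [a]. *)
Record cantor_scheme {X : topologicalType} (V : seq bool -> set X) : Prop :=
  CantorScheme {
    scheme_clopen : forall a, clopen (V a);
    scheme_nonempty : forall a, V a !=set0;
    scheme_nested : forall b a, V (b :: a) `<=` V a;
    scheme_disjoint : forall a, V (true :: a) `&` V (false :: a) = set0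
  }.

(** Diagonal argument: were [K] countable, with numbering [f], one could follow
a branch that at level [n] turns to a child free of the point numbered [n].
Compactness puts a point of [K] on the whole branch, contrary to the choice
made at the level of its own number. *)
Lemma cantor_scheme_uncountable {X : topologicalType} {V : seq bool -> set X}
    {K : set X} :
  cantor_scheme V -> compact K -> (forall a, K `&` V a !=set0) -> ~ countable K.
Proof.
move=> [clopenV _ nestV disjV] cK meetV /countable_injP[f injf].
have /choice[turn turnP] : forall na : nat * seq bool, exists b,
    forall y, K y -> f y = na.1 -> ~ V (b :: na.2) y.
  move=> [n a] /=.
  (* By injectivity of [f] the point numbered [n] is unique, and it lies in at
     most one of the two children. *)
  have [[y [Ky fy Vy]]|noy] := pselect (exists y, [/\ K y, f y = n & V (true :: a) y]).
    exists false => z Kz fz Vz.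
    have yz : y = z by apply: injf; rewrite ?inE // fy fz.
    have : (V (true :: a) `&` V (false :: a)) z by split=> //; rewrite -yz.
    by rewrite disjV.
  by exists true => y Ky fy Vy; apply: noy; exists y.
pose branch := fix branch n :=
  if n is m.+1 then turn (m, branch m) :: branch m else [::].
have [p Kp Vp] : exists2 p, K p & forall n, V (branch n) p.
  apply: compact_nested_meets => // n; first by have [] := clopenV (branch n).
  exact: nestV.
exact: turnP (f p, branch (f p)) p Kp erefl (Vp (f p).+1).
Qed.

(** * Cantor schemes in sets without isolated points *)

Lemma clopen_base_nbhs {X : topologicalType} {O : set X} {x : X} :
  has_clopen_base X -> open O -> O x ->
  exists W, [/\ clopen W, W x & W `<=` O].
Proof.
move=> [B [_ baseB] clopenB] oO Ox.
have [W [BW Wx] WO] := baseB x O (open_nbhs_nbhs (conj oO Ox)).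
by exists W; split=> //; exact: clopenB.
Qed.

(** Since no point of [V] is isolated, [V] is more than one point, and a clopen
set separating two of its points cuts it in two. *)
Lemma clopen_split {X : topologicalType} {V : set X} :
  has_clopen_base X -> hausdorff_space X ->
  open V -> V !=set0 -> V `<=` ~` isolated [set: X] ->
  exists W, [/\ clopen W, V `&` W !=set0 & V `&` ~` W !=set0].
Proof.
move=> zdimX hausX oV [x Vx] noiso.
have [y Vy xy] : exists2 y, V y & x != y.
  apply: contrapT => noy; apply: (noiso x Vx); split; first by rewrite inE.
  exists V; first exact: open_nbhs_nbhs.
  rewrite setIT eqEsubset; split=> [y Vy|_ -> //].
  by apply: contrapT => /eqP yx; apply: noy; exists y; rewrite // eq_sym.
have [A [oA]] := hausdorff_accessible hausX xy.
rewrite !inE => Ax nAy.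
have [W [clopenW Wx WA]] := clopen_base_nbhs zdimX oA Ax.
exists W; split=> //; first by exists x.
by exists y; split=> // /WA.
Qed.

Lemma exists_cantor_scheme {X : topologicalType} {U : set X} :
  has_clopen_base X -> hausdorff_space X ->
  clopen U -> U !=set0 -> U `<=` ~` isolated [set: X] ->
  exists V : seq bool -> set X, cantor_scheme V.
Proof.
move=> zdimX hausX clopenU U0 Uiso.
have /choice[W WP] : forall V, exists W,
    open V -> V !=set0 -> V `<=` ~` isolated [set: X] ->
    [/\ clopen W, V `&` W !=set0 & V `&` ~` W !=set0].
  move=> V.
  have [[oV V0 Viso]|nV] :=
      pselect [/\ open V, V !=set0 & V `<=` ~` isolated [set: X]].
    by have [W WP] := clopen_split zdimX hausX oV V0 Viso; exists W.
  by exists set0 => oV V0 Viso; case: nV.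
pose V := foldr (fun (b : bool) A => A `&` if b then W A else ~` W A) U.
have nestV b a : V (b :: a) `<=` V a by move=> x [].
have VP a : [/\ clopen (V a), V a !=set0 & V a `<=` ~` isolated [set: X]].
  elim: a => [//|b a [clopenA A0 Aiso]].
  have [clopenW AW AcW] := WP (V a) clopenA.1 A0 Aiso.
  split; last exact: subset_trans (nestV b a) Aiso.
    by apply: clopenI => //; case: (b) => //; exact: clopenC.
  by case: (b).
exists V; split=> // a; try by have [] := VP a.
by rewrite -subset0 => x [[_ Wx] [_]].
Qed.

(** * Density of the isolated points *)

Theorem corollary3p3 (X : topologicalType)
    (tychX : tychonoff_space X)
    (zdimX : has_clopen_base X)
    (cptX : compact [set: X])
    (d : Order.disp_t) (Gamma : porderType d) (r : Gamma -> X -> X)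
    (skel : r_skeleton r)
    (countr : forall s : Gamma, countable (range (r s))) :
  exists D : set X, dense D /\ D `<=` isolated [set: X].
Proof.
have [_ hausX] := tychX.
exists (isolated [set: X]); split=> // O [x Ox] oO.
apply: contrapT => noiso.
have [U [clopenU Ux UO]] := clopen_base_nbhs zdimX oO Ox.
have Uiso : U `<=` ~` isolated [set: X].
  by move=> y Uy isoy; apply: noiso; exists y; split=> //; exact: UO.
have [V scheme] := exists_cantor_scheme zdimX hausX clopenU (ex_intro _ x Ux) Uiso.
have /choice[t tP] : forall a, exists t, forall s,
    (t <= s)%O -> range (r s) `&` V a !=set0.
  move=> a.
  have [y Vy] := scheme_nonempty _ scheme a.
  have nVy : nbhs y (V a).
    by apply: open_nbhs_nbhs; split=> //; have [] := scheme_clopen _ scheme a.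
  have [t _ tV] := rsk_lim skel nVy.
  by exists t => s ts; exists (r s y); split; [exists y | exact: tV].
have [s ts] := countable_family_bounded [::] t
  (rsk_directed skel) (rsk_sigma_complete skel).
apply: (cantor_scheme_uncountable scheme _ _ (countr s)) => [|a]; last exact: tP.
apply: continuous_compact cptX; apply: continuous_subspaceT.
by have [] := rsk_retraction skel s.
Qed.
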